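(* Let $Q(z)$ be an $n\times n$ matrix function meromorphic on $\bar{\mathbb{C}}$ with $\chi(z):=\det Q(z)\not\equiv 0$, and let $\tilde D(z)=S(z)Q(z)T(z)$, where $S(z)$ and $T(z)$ are $n\times n$ matrix polynomials with constant nonzero determinants and $\tilde D(z)=\operatorname{diag}[\tilde d_1(z),\ldots,\tilde d_n(z)]$ with $\tilde d_i(z)$ rational scalar functions. Let $T_i(z)$ denote the $i$-th column of $T(z)$ and $\hat S_i(z)$ the $i$-th column of $S^{-1}(z)$. Let $\alpha\in\sigma_0(Q)$ be a zero of $\tilde d_i(z)$ of order $s_{i\alpha}$ for $i\in\Omega_0(\alpha)$, and let $\beta\in\sigma_p(Q)$ be a pole of $\tilde d_j(z)$ of order $t_{j\beta}$ for $j\in\Omega_p(\beta)$. Then: (i) The vector functions $\varphi_i(z):=T_i(z)$, $i\in\Omega_0(\alpha)$, are root functions of $Q(z)$ at $\alpha$ of orders $s_{i\alpha}$ corresponding to the eigenvectors $\varphi_i(\alpha)=T_i(\alpha)$; that is, they are the canonical root functions at $\alpha$. (ii) The vectors $\varphi_i(\alpha)$, $i\in\Omega_0(\alpha)$, are linearly independent, and they determine the geometric multiplicity at $\alpha$ (which equals the dimension of the following space) and the generalized kernel of $Q$ at $\alpha$ by $$\ker Q(z\to\alpha):=\operatorname{span}\{T_i(\alpha): i\in\Omega_0(\alpha)\}.$$ (iii) The functions $\psi_j(z):=T_j(z)\,\tilde d_j(z)^{-1}$, $j\in\Omega_p(\beta)$, are pole cancellation functions of $Q(z)$ at $\beta$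 of orders $t_{j\beta}$. (iv) The vector functions $\hat\varphi_j(z):=\hat S_j(z)$, $j\in\Omega_p(\beta)$, are root functions of $Q^{-1}(z)$ at $\beta$ of orders $t_{j\beta}$, corresponding to the eigenvectors $\hat\varphi_j(\beta)=\hat S_j(\beta)$; that is, they are the canonical pole functions of $Q(z)$ at $\beta$. (v) The vectors $\hat\varphi_j(\beta)$, $j\in\Omega_p(\beta)$, are linearly independent, and they determine the geometric multiplicity at $\beta$ (which equals the dimension of the following space) and the generalized kernel of $Q^{-1}$ at $\beta$ by $$\ker Q^{-1}(z\to\beta)=\operatorname{span}\{\hat S_j(\beta): j\in\Omega_p(\beta)\}.$$ (vi) The functions $\hat\psi_i(z):=\hat S_i(z)\,\tilde d_i(z)$, $i\in\Omega_0(\alpha)$, are pole cancellation functions of the inverse function $Q^{-1}(z)$ at the pole $\alpha$ of $Q^{-1}$, of orders $s_{i\alpha}$.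
   Context: $\bar{\mathbb{C}}:=\mathbb{C}\cup\{\infty\}$; a matrix function is meromorphic on $\bar{\mathbb{C}}$ if its only singularities on $\bar{\mathbb{C}}$ are poles. Root functions. Let $Q$ be an $n\times n$ meromorphic matrix function and $\alpha\in\mathbb{C}$. An $n$-dimensional vector function $\varphi(z)$, holomorphic at $\alpha$, is a root function of $Q$ of order at least $m\in\mathbb{N}$ at the zero (critical point) $\alpha$ if (a) $\varphi(\alpha)\neq 0$, and (b) $(Q(z)\varphi(z))^{(l)}\to 0$ as $z\to\alpha$ for $0\le l\le m-1$. If $m$ is the maximal number for which (b) holds, $\varphi$ has (exact) order $m$. The vector $\varphi(\alpha)$ is called an eigenvector corresponding to the eigenvalue (zero) $\alpha$. If $\varphi$ has maximal order among all root functions with the same eigenvector $\varphi(\alpha)$, then $\varphi$ is the canonical root function associated with $\varphi(\alpha)$. Pole functions and pole cancellation functions. Let $\beta\in\mathbb{C}$. Vector functions $\hat\varphi(z)$ and $\psi(z)$, with $\psi$ holomorphic at $\beta$, are a pole function and a pole cancellation function, respectively, of $Q$ at the pole $\beta$ of order at least $m\in\mathbb{N}$ if (a) $\hat\varphi(z):=Q(z)\psi(z)\to c=:\hat\varphi(\beta)$ as $z\to\beta$ with $c\ne0$, $c\neq\infty$, and (b) $\psi^{(l)}(z)\to 0$ as $z\to\beta$ for $0\le l\le m-1$. If $m$ is the maximal number with property (b), the (exact) order is $m$. A pole cancellation function of maximal order among all those associated with the same limit $\hat\varphi(\beta)$ is called canonical. A root function of $Q^{-1}$ is also called a pole function of $Q$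 of the same order, and a canonical root function of $Q^{-1}$ is a canonical pole function of $Q$. $\sigma_0(Q)$ is the set of all finite zeros of $Q$ (points $\alpha\in\mathbb{C}$ at which a root function of order at least $1$ exists), and $\sigma_p(Q)$ is the set of all finite poles of $Q$. Index sets: $\Omega_0(\alpha):=\{i\in\{1,\ldots,n\}:\tilde d_i(\alpha)=0\}$ and $\Omega_p(\beta):=\{i\in\{1,\ldots,n\}:\tilde d_i(\beta)^{-1}=0\}$. The geometric multiplicity of the zero $\alpha$ of $Q$ is the number of functions $\tilde d_i$ with $\tilde d_i(\alpha)=0$; the geometric multiplicity of the pole $\beta$ of $Q$ is that of $\beta$ as a zero of $Q^{-1}$. A point $\alpha$ may be both a zero and a pole of $Q$. *)

(* Defs.v *)
From HB Require Import structures.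
From mathcomp Require Import all_boot all_order all_algebra.
From mathcomp Require Import all_classical all_reals all_analysis.
From mathcomp Require Import complex.

Set Implicit Arguments.
Unset Strict Implicit.
Unset Printing Implicit Defensive.

Import Order.TTheory GRing.Theory Num.Theory.
Import numFieldNormedType.Exports.

Local Open Scope classical_set_scope.
Local Open Scope ring_scope.

(* Functions on C are total.  The value of a meromorphic function at an isolated
   singularity is therefore meaningless, and every notion below only looks at
   punctured neighbourhoods a^', or at points where the function is holomorphic
   (which includes the correct value at the point itself). *)

Definition Cplx (R : realType) : numClosedFieldType := R[i].

Section MeromorphicMatrixFunctions.
Variable R : realType.
Local Notation C := (Cplx R).

Definition holomorphic_at (f : C -> C) (a : C) : Prop :=
  \forall z \near a, derivable f z 1.

Definition mx_holomorphic_at m n (F : C -> 'M[C]_(m, n)) (a : C) : Prop :=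
  forall i j, holomorphic_at (fun z => F z i j) a.

Definition meromorphic_at (f : C -> C) (a : C) : Prop :=
  exists (g : C -> C) (k : nat), holomorphic_at g a /\
    \forall z \near a^', f z = g z / (z - a) ^+ k.

Definition mx_meromorphic_on_sphere m n (F : C -> 'M[C]_(m, n)) : Prop :=
  forall i j, (forall a, meromorphic_at (fun z => F z i j) a) /\
    meromorphic_at (fun w => F w^-1 i j) 0.

Definition zero_of_order (f : C -> C) (a : C) (s : nat) : Prop :=
  (0 < s)%N /\ exists g : C -> C, [/\ holomorphic_at g a, g a != 0 &
    \forall z \near a^', f z = (z - a) ^+ s * g z].

Definition pole_of_order (f : C -> C) (a : C) (t : nat) : Prop :=
  (0 < t)%N /\ exists g : C -> C, [/\ holomorphic_at g a, g a != 0 &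
    \forall z \near a^', f z = g z / (z - a) ^+ t].

(* F^(l) --> 0 at a for all l < m.  As [derive1n] is total, the existence of the
   derivatives of F up to order m - 1 near a has to be required explicitly. *)
Definition derivatives_vanish n (F : C -> 'cV[C]_n) (a : C) (m : nat) : Prop :=
  forall (l : nat) (i : 'I_n), (l < m)%N ->
    (forall k, (k < l)%N ->
       \forall z \near a^', derivable (derive1n k (fun w => F w i 0)) z 1) /\
    derive1n l (fun w => F w i 0) z @[z --> a^'] --> (0 : C).

Section SquareMatrixFunctions.
Variable n : nat.
Implicit Types (Q : C -> 'M[C]_n) (phi psi : C -> 'cV[C]_n) (a b : C).

Definition det_not_identically_zero Q : Prop :=
  exists z, mx_holomorphic_at Q z /\ \det (Q z) != 0.

(* When det Q is not identically zero, Q z is invertible off a discrete set;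
   [invmx] is only meaningful off that set. *)
Definition mxfun_inv Q : C -> 'M[C]_n := fun z => invmx (Q z).

Definition root_function_ge Q a phi (m : nat) : Prop :=
  [/\ (0 < m)%N, mx_holomorphic_at phi a, phi a != 0 &
      derivatives_vanish (fun z => Q z *m phi z) a m].

Definition root_function Q a phi (m : nat) : Prop :=
  root_function_ge Q a phi m /\
  forall m', root_function_ge Q a phi m' -> (m' <= m)%N.

Definition canonical_root_function Q a phi : Prop :=
  exists2 m, root_function Q a phi m &
    forall phi' m', root_function_ge Q a phi' m' -> phi' a = phi a ->
      (m' <= m)%N.

Definition zero_at Q a : Prop := exists phi, root_function_ge Q a phi 1.

Definition eigenvector Q a (v : 'cV[C]_n) : Prop :=
  exists2 phi, root_function_ge Q a phi 1 & phi a = v.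

(* The vectors to which some phi, holomorphic at a, tends with Q phi --> 0. *)
Definition generalized_kernel Q a : set 'cV[C]_n :=
  [set v | v = 0 \/ eigenvector Q a v].

Definition canonical_pole_function Q b phi : Prop :=
  canonical_root_function (mxfun_inv Q) b phi.

Definition pole_at Q b : Prop :=
  exists i j t, pole_of_order (fun z => Q z i j) b t.

Definition pole_cancellation_ge Q b psi (m : nat) : Prop :=
  [/\ (0 < m)%N, pole_at Q b, mx_holomorphic_at psi b,
      exists2 c : 'cV[C]_n, c != 0 &
        forall i, (Q z *m psi z) i 0 @[z --> b^'] --> c i 0 &
      derivatives_vanish psi b m].

Definition pole_cancellation_function Q b psi (m : nat) : Prop :=
  pole_cancellation_ge Q b psi m /\
  forall m', pole_cancellation_ge Q b psi m' -> (m' <= m)%N.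

(* A rational function in lowest terms: it has its correct value wherever it is
   finite, and since x / 0 = 0, both d z and (d z)^-1 evaluate to 0 at a pole z.
   In particular (d z)^-1 has its correct value at the poles of d. *)
Definition rational_function (d : C -> C) : Prop :=
  exists p q : {poly C}, [/\ q != 0, coprimep p q &
    forall z, d z = p.[z] / q.[z]].

Definition eval_mx (A : 'M[{poly C}]_n) (z : C) : 'M[C]_n :=
  map_mx (horner_eval z) A.

Definition unimodular (A : 'M[{poly C}]_n) : Prop :=
  exists2 c : C, c != 0 & \det A = c%:P.

Definition diagonalizes Q (S T : 'M[{poly C}]_n) (d : 'I_n -> C -> C) : Prop :=
  [/\ unimodular S, unimodular T, forall i, rational_function (d i) &
      forall z, mx_holomorphic_at Q z ->
        eval_mx S z *m Q z *m eval_mx T z = diag_mx (\row_i d i z)].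

(* "d_i(a) = 0" and "d_i(b)^-1 = 0" as limits, since d_i b is not infinite at a
   pole b of d_i. *)
Definition zero_indices (d : 'I_n -> C -> C) a : {set 'I_n} :=
  [set i | `[< d i z @[z --> a^'] --> (0 : C) >]]%SET.

Definition pole_indices (d : 'I_n -> C -> C) b : {set 'I_n} :=
  [set i | `[< (d i z)^-1 @[z --> b^'] --> (0 : C) >]]%SET.

(* The number of diagonal entries vanishing at a, which must be the same for all
   diagonalizations of Q. *)
Definition geometric_multiplicity Q a (k : nat) : Prop :=
  (exists S T d, diagonalizes Q S T d) /\
  forall S T d, diagonalizes Q S T d -> #|zero_indices d a| = k.

Definition pole_geometric_multiplicity Q b (k : nat) : Prop :=
  geometric_multiplicity (mxfun_inv Q) b k.

Definition Tcol (T : 'M[{poly C}]_n) (i : 'I_n) (z : C) : 'cV[C]_n :=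
  col i (eval_mx T z).

Definition Shat (S : 'M[{poly C}]_n) (i : 'I_n) (z : C) : 'cV[C]_n :=
  col i (invmx (eval_mx S z)).

End SquareMatrixFunctions.
End MeromorphicMatrixFunctions.

(* Main.v *)
Require Import Defs.
From HB Require Import structures.
From mathcomp Require Import all_boot all_order all_algebra.
From mathcomp Require Import all_classical all_reals all_analysis.
From mathcomp Require Import complex ring.

Set Implicit Arguments.
Unset Strict Implicit.
Unset Printing Implicit Defensive.

Import Order.TTheory GRing.Theory Num.Theory.
Import numFieldNormedType.Exports.

Local Open Scope classical_set_scope.
Local Open Scope ring_scope.

(** Near every point a, excluding a, the matrix Q is holomorphic, so
    Q = S^-1 D T^-1 there, with S, T and their inverses polynomial and D
    diagonal with rational entries d_i.  Reading Q phi in the coordinates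
    u = T^-1 phi gives S (Q phi) = D u, and everything about root functions is
    thereby reduced to the scalars d_i u_i.

    - For phi = T_i one gets Q T_i = d_i S^-1_i, a rational function vanishing
      to the order of d_i: so T_i is a root function of at least that order.

    - If phi is any root function of order m then, as the derivatives of Q phi
      up to order m - 1 tend to 0, Q phi = o(|z - a|^(m-1)), hence
      d_i u_i = o(|z - a|^(m-1)).  If phi and T_i agree at a then u_i tends
      to 1, and m cannot exceed the order of the zero of d_i.  This is the
      maximality that makes T_i canonical.

    - If Q phi tends to 0 then u_i(a) = 0 whenever d_i does not tend to 0, and
      conversely the combinations with constant coefficients of the T_i for
      which d_i tends to 0 are sent by Q to functions tending to 0.  So the generalized kernel is the
      span of the independent vectors T_i(a) ([generalized_kernelE]).  Since
      the kernel refers to no diagonalization, neither does the number of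
      vanishing d_i.

    - The functions d_i S^-1_i are mapped by Q^-1 to T_i, so they are pole
      cancellation functions of Q^-1; the same estimate bounds their order.
      That Q^-1 really has a pole at a follows from D^-1 = T^-1 Q^-1 S^-1: if
      all entries of Q^-1 had limits, so would 1 / d_i.

    The estimate above ([derivatives_vanish_small]) integrates the conditions
    on the derivatives of Q phi one after the other, by the mean value
    inequality along segments ending at a.

    The statements at poles are the statements at zeros applied to Q^-1, which
    is diagonalized by T^-1 and S^-1 with diagonal entries 1 / d_i
    ([diagonalizes_inv]). *)

(** * Germs in a punctured neighbourhood *)

Section NumField.
Variable K : numFieldType.
Implicit Types (f g : K -> K) (a z : K) (p q : {poly K}).

Lemma is_derive_horner p z : is_derive z 1 (horner p) p^`().[z].
Proof.
elim/poly_ind: p => [|p c ih].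
  rewrite deriv0 horner0 (_ : horner 0 = cst 0); first exact: is_derive_cst.
  by apply/funext => y; rewrite horner0.
rewrite (_ : horner _ = horner p * id + cst c); last first.
  by apply/funext => y; rewrite !hornerE.
apply: is_derive_eq.
by rewrite derivMXaddC !hornerE /= /GRing.scale /= mulr1 [z * _]mulrC.
Qed.

Lemma derivable_continuous f z : derivable f z 1 -> {for z, continuous f}.
Proof. by move=> /derivable1_diffP; exact: differentiable_continuous. Qed.

Lemma horner_cvg p a : p.[z] @[z --> a] --> p.[a].
Proof. by apply: derivable_continuous; case: (is_derive_horner p a). Qed.

Lemma horner_cvg_dnbhs p a : p.[z] @[z --> a^'] --> p.[a].
Proof. exact/continuous_withinNx/horner_cvg. Qed.

Lemma near_horner_neq0 p a : p.[a] != 0 -> \forall z \near a, p.[z] != 0.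
Proof. by apply: (cvgr_neq0 (FF := nbhs_filter a)); exact: horner_cvg. Qed.

(** A property of a punctured neighbourhood can be differentiated there: it
    holds in a whole neighbourhood of each of the nearby points. *)
Lemma near_dnbhs_near a (P : set K) :
  (\forall z \near a^', P z) -> \forall z \near a^', \forall w \near z, P w.
Proof.
move=> aP.
have /nbhs_dnbhs aaP : \forall z \near a, \forall w \near z, w != a -> P w.
  exact: near_join.
near=> z.
have za : z != a by near: z; exact: nbhs_dnbhs_neq.
have zaP : \forall w \near z, w != a -> P w by near: z.
have zX : \forall w \near z, ('X - a%:P).[w] != 0.
  by apply: near_horner_neq0; rewrite !hornerE subr_eq0.
by near=> w; apply: (near zaP w) => //; rewrite -subr_eq0 -[_ - _]hornerXsubC; near: w.
Unshelve. all: by end_near. Qed.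

(** The zeros of a polynomial are isolated: factor out the power of X - a. *)
Lemma near_dnbhs_horner_neq0 p a : p != 0 -> \forall z \near a^', p.[z] != 0.
Proof.
move=> pn0; have [m [q /implyP/(_ pn0) nq ->]] := multiplicity_XsubC p a.
have /nbhs_dnbhs qa := near_horner_neq0 nq.
near=> z; rewrite hornerM horner_exp !hornerE mulf_neq0//; first by near: z.
by rewrite expf_neq0// subr_eq0; near: z; exact: nbhs_dnbhs_neq.
Unshelve. all: by end_near. Qed.

Lemma is_derive_ratio p q z : q.[z] != 0 ->
  is_derive z 1 (fun w => p.[w] / q.[w])
    ((p^`().[z] * q.[z] - p.[z] * q^`().[z]) / q.[z] ^+ 2).
Proof.
move=> qz.
have dV : is_derive z 1 (fun w => (horner q w)^-1) (- q.[z] ^- 2 *: q^`().[z]).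
  have := is_derive_horner q z => -[dq <-].
  by split; [exact: derivableV|rewrite deriveV].
have dp := is_derive_horner p z.
have := is_deriveM dp dV; move/is_derive_eq; apply.
rewrite /= /GRing.scale/=; field; exact: qz.
Qed.

(** * Zeros of rational germs and their derivatives *)

Lemma dnbhs_eq_cvg f g a (l : K) : (\forall z \near a^', f z = g z) ->
  g z @[z --> a^'] --> l -> f z @[z --> a^'] --> l.
Proof.
move=> fg; apply: cvg_trans; apply: near_eq_cvg.
by apply: filterS fg => z ->.
Qed.

(** Rational germs vanishing at a to order at least m.  The class is closed
    under differentiation, m dropping by one, which settles all derivatives by
    induction. *)
Definition rational_zero_ge f a (m : nat) := exists p q, q.[a] != 0 /\
  \forall z \near a^', f z = (z - a) ^+ m * (p.[z] / q.[z]).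

Lemma rational_zero_ge_cvg0 f a m : (0 < m)%N -> rational_zero_ge f a m ->
  f z @[z --> a^'] --> 0.
Proof.
case: m => // m _ [p [q [qa fE]]].
apply: (dnbhs_eq_cvg fE).
have -> : 0 = (('X - a%:P) ^+ m.+1).[a] * (p.[a] / q.[a]).
  by rewrite horner_exp hornerXsubC subrr expr0n mul0r.
under eq_fun do rewrite -hornerXsubC -horner_exp.
apply: cvgM; first exact: horner_cvg_dnbhs.
by apply: cvgM; [exact: horner_cvg_dnbhs|apply: cvgV => //; exact: horner_cvg_dnbhs].
Qed.

(** With h = p / q, the derivative of (z - a)^(m+1) h is
    (z - a)^m ((m+1) h + (z - a) h'), again with denominator q^2 nonzero at a. *)
Lemma rational_zero_ge_derive f a m : rational_zero_ge f a m.+1 ->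
  (\forall z \near a^', derivable f z 1) /\ rational_zero_ge (derive1 f) a m.
Proof.
move=> [p [q [qa fE]]].
have /nbhs_dnbhs qn := near_horner_neq0 qa.
pose g z := ((('X - a%:P) ^+ m.+1 * p).[z] / q.[z]).
have fg : \forall z \near a^', f z = g z.
  apply: filterS fE => z ->.
  by rewrite /g hornerM horner_exp hornerXsubC mulrA.
have gd z : q.[z] != 0 -> is_derive z 1 g _ := @is_derive_ratio _ q z.
have fgn := near_dnbhs_near fg.
split.
  near=> z; apply: (@near_eq_derivable _ _ _ g).
    have : \forall w \near z, f w = g w by near: z.
    by apply: filterS => w.
  by apply: @ex_derive; apply: gd; near: z.
exists ((m.+1%:R *: p + ('X - a%:P) * p^`()) * q - ('X - a%:P) * p * q^`()), (q ^+ 2).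
split; first by rewrite horner_exp expf_neq0.
near=> z.
rewrite derive1E (@near_eq_derive _ _ _ _ g); last by near: z.
have qz : q.[z] != 0 by near: z.
have /@derive_val -> := gd z qz.
rewrite derivM deriv_exp derivXsubC !hornerE hornerMn !hornerE /=.
rewrite exprS -mulr_natl; field; exact: qz.
Unshelve. all: by end_near. Qed.

Lemma rational_zero_ge_derive1n f a m k : (k <= m)%N -> rational_zero_ge f a m ->
  rational_zero_ge (derive1n k f) a (m - k).
Proof.
elim: k => [|k ih] km fm; first by rewrite subn0.
have := ih (ltnW km) fm; rewrite -[(m - k)%N](subnSK km).
by move=> /rational_zero_ge_derive[].
Qed.

Lemma rational_zero_ge_derivatives_vanish f a m l : (l < m)%N -> rational_zero_ge f a m ->
  (forall k, (k < l)%N -> \forall z \near a^', derivable (derive1n k f) z 1) /\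
  derive1n l f z @[z --> a^'] --> 0.
Proof.
move=> lm fm; split => [k kl|].
  have km := ltn_trans kl lm.
  have := rational_zero_ge_derive1n (ltnW km) fm; rewrite -(subnSK km).
  by move=> /rational_zero_ge_derive[].
apply: (rational_zero_ge_cvg0 (m := m - l)); first by rewrite subn_gt0.
exact: rational_zero_ge_derive1n (ltnW lm) fm.
Qed.

End NumField.

(** * A mean value estimate for complex derivatives *)

Lemma derivable_direction (K : numFieldType) (f : K -> K) (x w : K) : derivable f x 1 ->
  derivable f x w /\ 'D_w f x = derive1 f x * w.
Proof.
move=> df; have dff : differentiable f x by exact/derivable1_diffP.
split; first exact: diff_derivable.
by rewrite (deriveE _ dff) deriv1E//= mulrC.
Qed.

Section Complex.
Variable R : realType.
Local Notation C := (Cplx R).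
Local Notation toC := (real_complex R : R -> C).
Implicit Types (f : C -> C) (a z w : C).

Lemma Re_cvg T (F : set_system T) (FF : Filter F) (u : T -> C) (l : C) :
  u x @[x --> F] --> l -> complex.Re (u x) @[x --> F] --> complex.Re l.
Proof.
move=> ul; apply/cvgrPdist_lt => e e0.
have e0C : 0 < toC e by rewrite ltcR.
move/cvgrPdist_lt: ul => /(_ _ e0C); apply: filterS => x.
rewrite -raddfB; move: (l - u x) => y yl.
rewrite -ltcR; exact: le_lt_trans (normc_ge_Re y) yl.
Qed.

Lemma norm_real_complex (x : R) : `|toC x : C| = toC `|x|.
Proof. by rewrite normc_def /= expr0n addr0 sqrtr_sqr. Qed.

Lemma real_complex_cvg0 : toC x @[x --> 0^'] --> 0^'.
Proof.
apply: continuous_injective_withinNx => [|y /= /complexI //].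
apply/cvgrPdist_lt => e e0.
have eE : e = toC (complex.Re e) by rewrite RRe_real// gtr0_real.
have re0 : 0 < complex.Re e by rewrite -ltcR -eE.
have : \forall t \near (0 : R), `|t| < complex.Re e by exact: nbhs0_lt.
apply: filterS => t te.
by rewrite -raddfB norm_real_complex eE ltcR sub0r normrN.
Qed.

(** Turns a complex derivative into a real one, to which the real mean value
    theorem applies; the factor c selects the direction in which the complex
    increment is measured. *)
Lemma is_derive_Re_segment f a w c (t : R) : derivable f (a + toC t * w) 1 ->
  is_derive t 1 (fun s : R => complex.Re (c * f (a + toC s * w)))
    (complex.Re (c * (derive1 f (a + toC t * w) * w))).
Proof.
set x := a + _ => dfx.
have [Dw DwE] := derivable_direction w dfx.
suff H : h^-1 *: (complex.Re (c * f (a + toC (h *: 1 + t) * w)) -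
    complex.Re (c * f x)) @[h --> (0:R)^'] -->
    complex.Re (c * (derive1 f x * w)).
  by split; [apply/cvg_ex; eexists; exact: H|apply: cvg_lim => //; exact: H].
rewrite -DwE.
have H : c * ((toC h)^-1 *: (f (toC h *: w + x) - f x)) @[h --> 0^'] --> c * 'D_w f x.
  apply: cvgM; first exact: cvg_cst.
  exact: (cvg_comp _ _ real_complex_cvg0 Dw).
apply: cvg_trans (Re_cvg _ H).
apply: near_eq_cvg; near=> h.
have mE : a + toC (h *: 1 + t) * w = toC h * w + x.
  by rewrite [h *: 1]mulr1 raddfD/= mulrDl /x addrCA addrA.
rewrite /= mE -raddfB -mulrBr /GRing.scale/= -fmorphV mulrCA.
by case: (c * _) => u v; rewrite /= mul0r subr0.
Unshelve. all: by end_near. Qed.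

(** The mean value theorem is false for complex values, but its inequality
    holds: take c to be the conjugate of the increment, so that the real
    function to which the theorem is applied increases by its squared norm. *)
Lemma norm_sub_le_segment f a z (M : C) :
  (forall t : R, 0 < t <= 1 -> derivable f (a + toC t * (z - a)) 1 /\
     `|derive1 f (a + toC t * (z - a))| * `|z - a| <= M) ->
  forall t : R, 0 < t < 1 -> `|f z - f (a + toC t * (z - a))| <= M.
Proof.
move=> df t0 /andP[t00 t01]; set w := z - a in df *.
set D := f z - _; pose c := D^*.
have ae1 : a + toC 1 * w = z by rewrite mul1r addrC subrK.
have dh t : t0 <= t <= 1 -> is_derive t 1 (fun s : R => complex.Re (c * f (a + toC s * w)))
    (complex.Re (c * (derive1 f (a + toC t * w) * w))).
  move=> /andP[tt0 t1]; apply: is_derive_Re_segment.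
  by have [] := df t _; rewrite ?t1 ?(lt_le_trans t00).
have hc : {within `[t0, 1], continuous (fun s : R => complex.Re (c * f (a + toC s * w)))}.
  apply: derivable_within_continuous => t; rewrite in_itv/= => tt.
  by case: (dh t tt).
have [t|t] := MVT (df := fun t => complex.Re (c * (derive1 f (a + toC t * w) * w))) t01 _ hc.
  by rewrite in_itv/= => /andP[/ltW t0t /ltW t1]; apply: dh; rewrite t0t.
rewrite in_itv/= ae1 -raddfB -mulrBr -/D => /andP[t0t t1] hE.
have t01' : 0 < t <= 1 by rewrite (lt_trans t00)//= ltW.
have [_ Mt] := df t t01'.
have M0 : 0 <= M by apply: le_trans Mt; rewrite mulr_ge0.
have [->|D0] := eqVneq D 0; first by rewrite normr0.
rewrite -(ler_pM2l (x := `|D|)) ?normr_gt0//.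
have -> : `|D| * `|D| = toC (complex.Re (c * D)).
  by rewrite mulrC -normCKC RRe_real// normCKC realX// ?normr_real.
rewrite hE (le_trans (y := toC `|complex.Re (c * (derive1 f (a + toC t * w) * w))|))//.
  rewrite lecR (le_trans (ler_norm _))// normrM ler_piMr//.
  by rewrite ger0_norm ?subr_ge0 ?gerBl ltW.
apply: le_trans (normc_ge_Re _) _.
by rewrite !normrM norm_conjC ler_wpM2l.
Qed.

(** The endpoint a, where the value of f is meaningless, is reached as the
    limit of the points a + t (z - a). *)
Lemma norm_le_segment f a z (M : C) : z != a ->
  f w @[w --> a^'] --> 0 ->
  (forall t : R, 0 < t <= 1 -> derivable f (a + toC t * (z - a)) 1 /\
     `|derive1 f (a + toC t * (z - a))| * `|z - a| <= M) ->
  `|f z| <= M.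
Proof.
move=> za f0 df0; have df := norm_sub_le_segment df0.
have affine : a + h * (z - a) @[h --> (0 : C)^'] --> (a + 0 * (z - a))^'.
  apply: (@continuous_injective_withinNx _ _ (fun h : C => a + h * (z - a)) 0).
    rewrite (_ : (fun h => _) = horner ((z - a) *: 'X + a%:P)); first exact: horner_cvg.
    by apply/funext => h; rewrite !hornerE addrC mulrC.
  by move=> y /addrI/mulIf; apply; rewrite subr_eq0.
rewrite mul0r addr0 in affine.
have toa := cvg_comp _ _ real_complex_cvg0 affine.
have fa : f (a + toC t * (z - a)) @[t --> 0^'] --> 0 by exact: cvg_comp toa f0.
have M0 : 0 <= M.
  by have [_] := df0 1 (introT andP (conj ltr01 (lexx 1))); apply: le_trans; rewrite mulr_ge0.
rewrite real_leNgt ?ger0_real//; apply/negP => Mf.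
move: Mf; rewrite -subr_gt0 => Mf.
have /cvgr0Pnorm_lt/(_ _ Mf) small := cvg_dnbhs_at_right fa.
suff [t [t01]] : exists t : R, 0 < t < 1 /\ `|f (a + toC t * (z - a))| < `|f z| - M.
  rewrite ltrBrDr; apply/negP; rewrite -real_leNgt ?realD ?normr_real ?ger0_real//.
  rewrite -[X in `|X|](subrK (f (a + toC t * (z - a)))) (le_trans (ler_normD _ _))//.
  by rewrite addrC lerD2l df.
have ev : \forall t \near 0^'+,
    `|f (a + toC t * (z - a))| < `|f z| - M /\ (0 < t /\ t < 1).
  by near=> t; do !split; near: t; [exact: small|exact: nbhs_right_gt|exact: nbhs_right_lt].
have [t [tf [t0 t1]]] := @filter_ex _ (0^'+ : set_system R) _ _ ev.
by exists t; rewrite t0.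
Unshelve. all: by end_near. Qed.

(** Integration raises the order of smallness by one: on the segment from a to
    z the derivative is bounded by e |z - a|^k, whence |f z| is bounded by
    e |z - a|^(k+1). *)
Lemma derive_small f a k :
  (\forall z \near a^', derivable f z 1) -> f z @[z --> a^'] --> 0 ->
  derive1 f z / (z - a) ^+ k @[z --> a^'] --> 0 ->
  f z / (z - a) ^+ k.+1 @[z --> a^'] --> 0.
Proof.
move=> df f0 f'0; apply/cvgr0Pnorm_le => e e0.
have /cvgr0Pnorm_le/(_ _ e0) f'e := f'0.
have /nbhs_ballP[r /= r0 rP] : \forall z \near a, z != a ->
    derivable f z 1 /\ `|derive1 f z / (z - a) ^+ k| <= e.
  exact: filterI df f'e.
have near_r : \forall z \near a, ball a r z by exact: nbhsx_ballx.
apply: filterS near_r => z; rewrite /ball/= distrC => zr za.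
have za0 : 0 < `|z - a| by rewrite normr_gt0 subr_eq0.
rewrite normrM normfV normrX ler_pdivrMr ?exprn_gt0//.
apply: (norm_le_segment za f0) => t /andP[t0 t1].
have tza : a + toC t * (z - a) - a = toC t * (z - a) by rewrite addrC addKr.
have tle : `|toC t * (z - a)| <= `|z - a|.
  rewrite normrM ler_piMl// norm_real_complex ger0_norm ?(ltW t0)//.
  by rewrite -[1](rmorph1 (real_complex R)) lecR.
have [||dfx] := rP (a + toC t * (z - a)).
- by rewrite /ball/= distrC tza (le_lt_trans tle).
- rewrite -subr_eq0 tza mulf_neq0//; last by rewrite subr_eq0.
  by rewrite fmorph_eq0 gt_eqF.
rewrite /= tza normrM normfV normrX => le_e; split => //.
have tw0 : 0 < `|toC t * (z - a)|.
  by rewrite normrM mulr_gt0// normr_gt0 fmorph_eq0 gt_eqF.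
rewrite exprSr mulrA ler_wpM2r//.
rewrite (ler_pdivrMr _ _ (exprn_gt0 k tw0)) in le_e.
apply: (le_trans le_e); apply: ler_wpM2l; first exact: ltW.
by apply: lerXn2r => //; rewrite nnegrE.
Qed.

(** Descends from the highest derivative, which is o(1), to f itself. *)
Lemma derivatives_vanish_small f a m :
  (forall l, (l <= m)%N ->
    (forall k, (k < l)%N -> \forall z \near a^', derivable (derive1n k f) z 1) /\
    derive1n l f z @[z --> a^'] --> 0) ->
  f z / (z - a) ^+ m @[z --> a^'] --> 0.
Proof.
elim: m f => [|m ih] f fm.
  have [_ /= f0] := fm 0 isT.
  by under eq_fun do rewrite expr0 divr1.
apply: derive_small; [by have [/(_ 0 isT)] := fm m.+1 (leqnn _)|by have [] := fm 0 isT|].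
apply: ih => l lm; have [dl l0] := fm l.+1 lm; rewrite -derive1Sn; split => // k kl.
by rewrite -derive1Sn; exact: dl.
Qed.

End Complex.

(** * Spans of columns of an invertible matrix *)

Section LinearAlgebra.
Variables (F : fieldType) (n : nat) (M : 'M[F]_n).
Hypothesis Munit : M \in unitmx.

Lemma invmx_mul_col (i j : 'I_n) : (invmx M *m col j M) i 0 = (i == j)%:R.
Proof. by rewrite colE mulmxA mulVmx// mul1mx !mxE eqxx andbT. Qed.

Lemma invmx_mul_sum_cols (m : nat) (k : 'I_m -> F) (g : 'I_m -> 'I_n) (i : 'I_n) :
  (invmx M *m (\sum_l k l *: col (g l) M)) i 0 = \sum_l k l * (i == g l)%:R.
Proof.
rewrite mulmx_sumr summxE; apply: eq_bigr => l _.
by rewrite -scalemxAr mxE invmx_mul_col.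
Qed.

Lemma nth_map_col m (s : m.-tuple 'I_n) (l : 'I_m) :
  (map (fun i => col i M) s)`_l = col (tnth s l) M.
Proof. by rewrite -[map _ _]/(tval (map_tuple (fun i => col i M) s)) -tnth_nth tnth_map. Qed.

Lemma free_cols (A : {set 'I_n}) : free [seq col i M | i in A].
Proof.
rewrite /image_mem; set s := in_tuple (enum A).
rewrite -[[seq _ | i <- _]]/(tval (map_tuple (fun i => col i M) s)).
apply/freeP => k k0 l.
have := invmx_mul_sum_cols k (tnth s) (tnth s l).
under eq_bigr do rewrite -nth_map_col.
rewrite k0 mulmx0 mxE (bigD1 l)//= eqxx mulr1 big1 ?addr0// => i il.
have /negPf-> : tnth s l != tnth s i; last by rewrite mulr0.
by apply: contra il => /eqP/tuple_uniqP-> //; exact: enum_uniq.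
Qed.

(** Multiplying by the inverse of M sends the columns of M to the standard
    basis, so membership in the span is read off the coordinates. *)
Lemma memv_span_cols (A : {set 'I_n}) (v : 'cV[F]_n) :
  reflect (forall i, i \notin A -> (invmx M *m v) i 0 = 0)
          (v \in <<[seq col i M | i in A]>>%VS).
Proof.
apply: (iffP idP) => [|v0].
  rewrite /image_mem; set s := in_tuple (enum A).
  rewrite -[[seq _ | i <- _]]/(tval (map_tuple (fun i => col i M) s)) => vX i iA.
  rewrite (coord_span vX); under eq_bigr do rewrite nth_map_col.
  rewrite invmx_mul_sum_cols big1// => l _.
  have /negPf-> : i != tnth s l; last by rewrite mulr0.
  by apply: contra iA => /eqP->; rewrite -mem_enum mem_tnth.
have -> : v = \sum_i (invmx M *m v) i 0 *: col i M.
  rewrite -[LHS](mulKVmx Munit); apply/colP => j; rewrite !mxE summxE.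
  by apply: eq_bigr => i _; rewrite !mxE mulrC.
apply: memv_suml => i _; have [iA|/v0->] := boolP (i \in A).
  by apply/memvZ/memv_span/map_f; rewrite mem_enum.
by rewrite scale0r mem0v.
Qed.

End LinearAlgebra.

(** * Limits and orders of scalar quotients *)

Section Scalar.
Variable K : numFieldType.
Implicit Types (f g : K -> K) (a z : K) (p q : {poly K}).

Lemma cvg_dnbhs_unique f a (l l' : K) :
  f z @[z --> a^'] --> l -> f z @[z --> a^'] --> l' -> l = l'.
Proof. by move=> h h'; apply: (cvg_unique (@norm_hausdorff _ K) h h'). Qed.

Lemma sum_cvg (I : Type) (r : seq I) a (f : I -> K -> K) (l : I -> K) :
  (forall i, f i z @[z --> a^'] --> l i) ->
  \sum_(i <- r) f i z @[z --> a^'] --> \sum_(i <- r) l i.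
Proof.
move=> fl; elim: r => [|i r ih].
  by under eq_fun do rewrite big_nil; rewrite big_nil; exact: cvg_cst.
by under eq_fun do rewrite big_cons; rewrite big_cons; exact: cvgD.
Qed.

Lemma mulmx_cvg m n k a (A : K -> 'M[K]_(m, n)) (B : K -> 'M[K]_(n, k))
    (A0 : 'M[K]_(m, n)) (B0 : 'M[K]_(n, k)) :
  (forall i j, A z i j @[z --> a^'] --> A0 i j) ->
  (forall i j, B z i j @[z --> a^'] --> B0 i j) ->
  forall i j, (A z *m B z) i j @[z --> a^'] --> (A0 *m B0) i j.
Proof.
move=> AA BB i j; rewrite mxE; under eq_fun do rewrite mxE.
by apply: sum_cvg => h; exact: cvgM.
Qed.

Lemma numerator_neq0 f p q : (forall z, f z = p.[z] / q.[z]) ->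
  (exists z, f z != 0) -> p != 0.
Proof.
by move=> fE [z]; rewrite fE; apply: contraNneq => ->; rewrite horner0 mul0r.
Qed.

Lemma ratio_cvg p q a : q.[a] != 0 -> p.[z] / q.[z] @[z --> a^'] --> p.[a] / q.[a].
Proof.
by move=> qa; apply: cvgM; [exact: horner_cvg_dnbhs|apply: cvgV => //; exact: horner_cvg_dnbhs].
Qed.

(** In lowest terms, a zero of the numerator is not a zero of the denominator;
    so the limit 0 is visible on the numerator alone. *)
Lemma ratio_cvg0P p q a : q != 0 -> coprimep p q ->
  (p.[z] / q.[z] @[z --> a^'] --> 0) <-> root p a.
Proof.
move=> q0 pq; split => [d0|pa]; last first.
  have -> : 0 = p.[a] / q.[a] by rewrite (rootP pa) mul0r.
  exact/ratio_cvg/(coprimep_root pq).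
apply/rootP; apply: (cvg_dnbhs_unique (horner_cvg_dnbhs (a := a))).
have dq : p.[z] / q.[z] * q.[z] @[z --> a^'] --> 0.
  by rewrite -[0](mul0r q.[a]); apply: cvgM => //; exact: horner_cvg_dnbhs.
apply: dnbhs_eq_cvg dq.
by near=> z; rewrite divfK//; near: z; exact: near_dnbhs_horner_neq0.
Unshelve. all: by end_near. Qed.

(** Links the analytic order of a zero, where g is only known to be continuous,
    to the multiplicity of the root a of p = p1 (X - a)^m: if m < s, then
    p1 / q = (z - a)^(s - m) g would tend to 0 although p1 does not vanish at
    a. *)
Lemma ratio_factor p q g a s : q != 0 -> root p a -> coprimep p q -> p != 0 ->
  {for a, continuous g} -> g a != 0 ->
  (\forall z \near a^', p.[z] / q.[z] = (z - a) ^+ s * g z) ->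
  exists p1, p = p1 * ('X - a%:P) ^+ s.
Proof.
move=> q0 pa pq p0 gc ga pg.
have [m [p1 /implyP/(_ p0) p1a pE]] := multiplicity_XsubC p a.
have qa : q.[a] != 0 by exact: coprimep_root pa.
have [sm|ms] := leqP s m.
  exists (p1 * ('X - a%:P) ^+ (m - s)); by rewrite -mulrA -exprD subnK.
exfalso; move/negP: p1a; apply.
have : p1.[z] / q.[z] @[z --> a^'] --> 0.
  apply: (@dnbhs_eq_cvg _ _ (fun z => ('X - a%:P).[z] ^+ (s - m) * g z)).
    near=> z; have za : z - a != 0 by rewrite subr_eq0; near: z; exact: nbhs_dnbhs_neq.
    apply: (mulfI (expf_neq0 m za)).
    rewrite !hornerE/= -exprD subnKC ?(ltnW ms)//.
    have <- : p.[z] / q.[z] = (z - a) ^+ s * g z by near: z.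
    by rewrite pE !hornerE/=; ring.
  have -> : 0 = ('X - a%:P).[a] ^+ (s - m) * g a.
    by rewrite hornerXsubC subrr expr0n subn_eq0 leqNgt ms mul0r.
  under eq_fun do rewrite -horner_exp; rewrite -horner_exp.
  apply: cvgM; first exact: horner_cvg_dnbhs.
  exact/continuous_withinNx.
move/(cvg_dnbhs_unique (ratio_cvg (p := p1) qa))/eqP.
by rewrite mulf_eq0 invr_eq0 (negPf qa) orbF.
Unshelve. all: by end_near. Qed.

(** The comparison behind every maximality claim: a zero of exact order s
    multiplied by a factor with nonzero limit is not o((z - a)^m) for m >= s. *)
Lemma zero_order_gt f g v a (v0 : K) s m :
  {for a, continuous g} -> g a != 0 -> (\forall z \near a^', f z = (z - a) ^+ s * g z) ->
  v z @[z --> a^'] --> v0 -> v0 != 0 ->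
  f z * v z / (z - a) ^+ m @[z --> a^'] --> 0 -> (m < s)%N.
Proof.
move=> gc ga fg vv v00 fv0; rewrite ltnNge; apply/negP => sm.
have gv : g z * v z @[z --> a^'] --> g a * v0.
  by apply: cvgM => //; exact/continuous_withinNx.
have gv0 : g z * v z @[z --> a^'] --> 0.
  apply: (@dnbhs_eq_cvg _ _ (fun z => ('X - a%:P).[z] ^+ (m - s) * (f z * v z / (z - a) ^+ m))).
    near=> z; have za : z - a != 0 by rewrite subr_eq0; near: z; exact: nbhs_dnbhs_neq.
    have -> : f z = (z - a) ^+ s * g z by near: z.
    rewrite hornerXsubC -{2}(subnK sm) exprD.
    by field; rewrite !expf_neq0.
  under eq_fun do rewrite -horner_exp.
  rewrite -[0](mulr0 (('X - a%:P) ^+ (m - s)).[a]).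
  by apply: cvgM => //; exact: horner_cvg_dnbhs.
have /eqP := cvg_dnbhs_unique gv gv0.
by rewrite mulf_eq0 (negPf ga) (negPf v00).
Unshelve. all: by end_near. Qed.

(** Common denominators make this class closed under sums and products, which
    is how the entries of Q^-1 = T D^-1 S are controlled. *)
Definition rational_near a f := exists p q, q != 0 /\
  \forall z \near a^', f z = p.[z] / q.[z].

Lemma rational_nearD a f g : rational_near a f -> rational_near a g ->
  rational_near a (fun z => f z + g z).
Proof.
move=> [p [q [q0 fE]]] [p' [q' [q'0 gE]]].
exists (p * q' + p' * q), (q * q'); split; first by rewrite mulf_neq0.
near=> z.
have -> : f z = p.[z] / q.[z] by near: z.
have -> : g z = p'.[z] / q'.[z] by near: z.
have qz : q.[z] != 0 by near: z; exact: near_dnbhs_horner_neq0.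
have q'z : q'.[z] != 0 by near: z; exact: near_dnbhs_horner_neq0.
by rewrite !hornerE; field; rewrite q'z.
Unshelve. all: by end_near. Qed.

Lemma rational_nearM a f g : rational_near a f -> rational_near a g ->
  rational_near a (fun z => f z * g z).
Proof.
move=> [p [q [q0 fE]]] [p' [q' [q'0 gE]]].
exists (p * p'), (q * q'); split; first by rewrite mulf_neq0.
near=> z.
have -> : f z = p.[z] / q.[z] by near: z.
have -> : g z = p'.[z] / q'.[z] by near: z.
by rewrite !hornerM mulf_div.
Unshelve. all: by end_near. Qed.

Lemma rational_near_poly a p : rational_near a (horner p).
Proof.
exists p, 1; split; first exact: oner_neq0.
by apply: nearW => z; rewrite hornerC divr1.
Qed.

Lemma rational_near_mulmx m n k a (A : K -> 'M[K]_(m, n)) (B : K -> 'M[K]_(n, k)) :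
  (forall i j, rational_near a (fun z => A z i j)) ->
  (forall i j, rational_near a (fun z => B z i j)) ->
  forall i j, rational_near a (fun z => (A z *m B z) i j).
Proof.
move=> rA rB i j; under eq_fun do rewrite mxE.
elim: index_enum => [|h r ih].
  under eq_fun do rewrite big_nil -[0](horner0 0).
  by exists 0, 1; split; [exact: oner_neq0|apply: nearW => z; rewrite !horner0 mul0r].
under eq_fun do rewrite big_cons.
by apply: rational_nearD => //; exact: rational_nearM.
Qed.

Lemma rational_near_derivable a f : rational_near a f ->
  \forall z \near a^', derivable f z 1.
Proof.
move=> [p [q [q0 /near_dnbhs_near fE]]].
have qn := near_dnbhs_horner_neq0 a q0.
near=> z.
have qz : q.[z] != 0 by near: z.
have [dr _] := is_derive_ratio p qz.
apply: near_eq_derivable dr.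
have : \forall w \near z, f w = p.[w] / q.[w] by near: z.
by apply: filterS => w ->.
Unshelve. all: by end_near. Qed.

End Scalar.

(** * Holomorphic and meromorphic functions *)

Section Holomorphic.
Variable R : realType.
Local Notation C := (Cplx R).
Implicit Types (f g : C -> C) (a z : C) (p q : {poly C}).

Lemma holomorphic_continuous f a : holomorphic_at f a -> {for a, continuous f}.
Proof. by move=> /nbhs_singleton; exact: derivable_continuous. Qed.

Lemma holomorphic_cvg f a : holomorphic_at f a -> f z @[z --> a^'] --> f a.
Proof. by move=> /holomorphic_continuous/continuous_withinNx. Qed.

Lemma holomorphic_ratio p q a : q.[a] != 0 -> holomorphic_at (fun z => p.[z] / q.[z]) a.
Proof.
move=> /near_horner_neq0; apply: filterS => z qz.
by case: (is_derive_ratio p qz).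
Qed.

Lemma holomorphic_horner p a : holomorphic_at (horner p) a.
Proof.
have : \forall z \near a, True by exact: filterT.
by apply: filterS => z _; case: (is_derive_horner p z).
Qed.

(** Compare the multiplicities of a in the denominator and the numerator. *)
Lemma rational_near_pole_or_cvg f a : rational_near a f ->
  (exists t, pole_of_order f a t) \/ (exists l : C, f z @[z --> a^'] --> l).
Proof.
move=> [p [q [q0 fE]]].
have [p0|p0] := eqVneq p 0.
  right; exists 0; apply: (@dnbhs_eq_cvg _ _ (fun=> 0)); last exact: cvg_cst.
  by apply: filterS fE => z ->; rewrite p0 horner0 mul0r.
have [m [p1 /implyP/(_ p0) p1a pE]] := multiplicity_XsubC p a.
have [k [q1 /implyP/(_ q0) q1a qE]] := multiplicity_XsubC q a.
have az : \forall z \near a^', z - a != 0.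
  by apply: filterS (nbhs_dnbhs_neq a) => z; rewrite subr_eq0.
have [km|mk] := leqP k m.
  right; exists (((p1 * ('X - a%:P) ^+ (m - k)).[a]) / q1.[a]).
  apply: dnbhs_eq_cvg (ratio_cvg (p := p1 * ('X - a%:P) ^+ (m - k)) q1a).
  apply: filterS2 fE az => z -> za.
  rewrite pE qE !hornerE/= -{1}(subnK km) exprD mulrA invfM mulrACA divff ?mulr1//.
  exact: expf_neq0.
left; exists (k - m)%N; split; first by rewrite subn_gt0.
exists (fun z => p1.[z] / q1.[z]); split; first exact: holomorphic_ratio.
  by rewrite mulf_neq0 ?invr_eq0.
apply: filterS2 fE az => z -> za.
rewrite pE qE !hornerE/= -{1}(subnK (ltnW mk)) exprD.
by rewrite mulrA -mulf_div divff ?expf_neq0// mulr1 invfM mulrA.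
Qed.

Lemma meromorphic_derivable f a : meromorphic_at f a ->
  \forall z \near a^', derivable f z 1.
Proof.
move=> [g [k [/nbhs_dnbhs hg /near_dnbhs_near fg]]].
near=> z; have za : ('X - a%:P).[z] != 0.
  by rewrite hornerXsubC subr_eq0; near: z; exact: nbhs_dnbhs_neq.
have dg : derivable g z 1 by near: z.
have Xz : (('X - a%:P) ^+ k).[z] != 0 by rewrite horner_exp expf_neq0.
have [dr _] := is_derive_ratio 1 Xz.
apply: near_eq_derivable (derivableM dg dr).
have : \forall w \near z, f w = g w / (w - a) ^+ k by near: z.
apply: filterS => w ->.
rewrite -[LHS]/(g w * ((1 : {poly C}).[w] / (('X - a%:P) ^+ k).[w])).
by rewrite hornerC div1r horner_exp hornerXsubC.
Unshelve. all: by end_near. Qed.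

Lemma near_mx_holomorphic m n (F : C -> 'M[C]_(m, n)) a :
  (forall i j, \forall z \near a^', derivable (fun w => F w i j) z 1) ->
  \forall z \near a^', mx_holomorphic_at F z.
Proof.
move=> FF.
have : \forall z \near a^', forall i j, holomorphic_at (fun w => F w i j) z.
  apply: filter_forall => i; apply: filter_forall => j.
  exact: near_dnbhs_near (FF i j).
by [].
Qed.

End Holomorphic.

(** * Unimodular polynomial matrices *)

Section Eval.
Variables (R : realType) (n : nat).
Local Notation C := (Cplx R).
Implicit Types (A B : 'M[{poly C}]_n) (z a : C).

Lemma eval_mxM A B z : eval_mx (A *m B) z = eval_mx A z *m eval_mx B z.
Proof. exact: map_mxM. Qed.

Lemma eval_mx_cvg A a i j : eval_mx A z i j @[z --> a^'] --> eval_mx A a i j.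
Proof. by under eq_fun do rewrite mxE; rewrite mxE; exact: horner_cvg_dnbhs. Qed.

Lemma unimodular_unitmx A : unimodular A -> A \in unitmx.
Proof. by move=> [c c0 dA]; rewrite unitmxE dA poly_unitE size_polyC c0 coefC eqxx unitfE. Qed.

(** The inverse is taken over the polynomial ring; this is why the columns of
    S^-1 are polynomial, hence holomorphic everywhere. *)
Lemma unimodular_invmx A : unimodular A -> unimodular (invmx A).
Proof.
move=> uA; have Au := unimodular_unitmx uA; case: uA => c c0 dA.
exists c^-1; first by rewrite invr_eq0.
have cP0 : c%:P != 0 by rewrite polyC_eq0.
apply: (mulfI cP0); rewrite -{1}dA -det_mulmx mulmxV// det1.
by rewrite -polyCM divff.
Qed.

Lemma eval_mulmxV A z : unimodular A -> eval_mx A z *m eval_mx (invmx A) z = 1%:M.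
Proof. by move=> /unimodular_unitmx uA; rewrite -eval_mxM mulmxV// [LHS]map_mx1. Qed.

Lemma eval_mulVmx A z : unimodular A -> eval_mx (invmx A) z *m eval_mx A z = 1%:M.
Proof. by move=> /unimodular_unitmx uA; rewrite -eval_mxM mulVmx// [LHS]map_mx1. Qed.

Lemma eval_unitmx A z : unimodular A -> eval_mx A z \in unitmx.
Proof. by move=> /eval_mulmxV => /(_ z)/mulmx1_unit[]. Qed.

Lemma invmx_eval A z : unimodular A -> invmx (eval_mx A z) = eval_mx (invmx A) z.
Proof.
move=> uA; rewrite -[LHS]mulmx1 -(eval_mulmxV z uA) mulKmx//.
exact: eval_unitmx.
Qed.

Lemma ShatE A i z : unimodular A -> Shat A i z = Tcol (invmx A) i z.
Proof. by move=> uA; rewrite /Shat invmx_eval. Qed.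

End Eval.

(** * The generalized kernel *)

Section Diagonalized.
Variables (R : realType) (n : nat).
Local Notation C := (Cplx R).
Variables (Q : C -> 'M[C]_n) (S T : 'M[{poly C}]_n) (d : 'I_n -> C -> C) (a : C).
Hypothesis uS : unimodular S.
Hypothesis uT : unimodular T.
Hypothesis rd : forall i, rational_function (d i).
Hypothesis SQT : \forall z \near a^',
  eval_mx S z *m Q z *m eval_mx T z = diag_mx (\row_i d i z).

Local Notation D z := (diag_mx (\row_i d i z)).

Lemma zero_indicesP i p q : q != 0 -> coprimep p q ->
  (forall z, d i z = p.[z] / q.[z]) ->
  (i \in zero_indices d a) = root p a.
Proof.
move=> q0 pq dE; rewrite inE; apply/asboolP/idP.
  by under eq_fun do rewrite dE; move/(ratio_cvg0P _ q0 pq).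
by move=> pa; under eq_fun do rewrite dE; exact/(ratio_cvg0P _ q0 pq).
Qed.

Lemma zero_indices_cvg i : i \in zero_indices d a -> d i z @[z --> a^'] --> (0 : C).
Proof. by rewrite inE => /asboolP. Qed.

(** Multiplying Q phi by the polynomial matrix S preserves o((z - a)^m), and
    S (Q phi) = D (T^-1 phi). *)
Lemma root_coord_small phi m i : derivatives_vanish (fun z => Q z *m phi z) a m.+1 ->
  d i z * (eval_mx (invmx T) z *m phi z) i 0 / (z - a) ^+ m @[z --> a^'] --> (0 : C).
Proof.
move=> dv.
have small j : ((z - a) ^- m *: (Q z *m phi z)) j 0 @[z --> a^'] --> (0 : C).
  under eq_fun do rewrite mxE mulrC.
  by apply: derivatives_vanish_small => l lm; exact: dv.
have /= := mulmx_cvg (@eval_mx_cvg R n S a) (B0 := 0).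
move=> /(_ _ (fun z => (z - a) ^- m *: (Q z *m phi z))) Sc.
have {Sc} : (eval_mx S z *m ((z - a) ^- m *: (Q z *m phi z))) i 0 @[z --> a^'] --> (0 : C).
  rewrite -[X in _ --> X](_ : (eval_mx S a *m (0 : 'cV[C]_n)) i 0 = 0); last first.
    by rewrite mulmx0 mxE.
  by apply: Sc => k l; rewrite ord1 mxE.
apply: dnbhs_eq_cvg; apply: filterS SQT => z SQTz.
have SQ : eval_mx S z *m Q z = D z *m eval_mx (invmx T) z.
  by rewrite -SQTz -mulmxA eval_mulmxV// mulmx1.
by rewrite -scalemxAr mulmxA SQ -mulmxA mul_diag_mx !mxE mulrC.
Qed.

Lemma holomorphic_coord_cvg phi i : mx_holomorphic_at phi a ->
  (eval_mx (invmx T) z *m phi z) i 0 @[z --> a^'] --> (eval_mx (invmx T) a *m phi a) i (0 : 'I_1).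
Proof.
move=> hphi; apply: mulmx_cvg; first exact: eval_mx_cvg.
by move=> k l; exact: holomorphic_cvg.
Qed.

(** With d_i = p / q, the product p u_i = q (d_i u_i) tends to 0, while p has a
    nonzero value at a. *)
Lemma root_function_coord0 phi i : mx_holomorphic_at phi a ->
  derivatives_vanish (fun z => Q z *m phi z) a 1 -> i \notin zero_indices d a ->
  (eval_mx (invmx T) a *m phi a) i 0 = 0.
Proof.
move=> hphi /root_coord_small-/(_ i) dv.
have [p [q [q0 pq dE]]] := rd i; rewrite (zero_indicesP q0 pq dE) => pa.
pose u : C -> C := fun z => (eval_mx (invmx T) z *m phi z) i 0.
have uc := holomorphic_coord_cvg (i := i) hphi.
have pu : p.[z] * u z @[z --> a^'] --> p.[a] * u a.
  exact: (cvgM (@horner_cvg_dnbhs _ p a) uc).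
have pu0 : p.[z] * u z @[z --> a^'] --> q.[a] * 0.
  apply: (@dnbhs_eq_cvg _ _ (fun z => q.[z] * (d i z * u z / (z - a) ^+ 0))); last first.
    exact: (cvgM (@horner_cvg_dnbhs _ q a) dv).
  apply: filterS (near_dnbhs_horner_neq0 a q0) => z qz.
  by rewrite dE expr0 divr1 mulrA mulrCA divff// mulr1.
have /eqP := cvg_dnbhs_unique pu pu0.
by rewrite mulr0 mulf_eq0 -/(root p a) (negPf pa) => /eqP.
Qed.

(** Q T c = S^-1 D c, and the i-th entry of D c is d_i c_i, in which d_i tends
    to 0 or c_i = 0. *)
Lemma kernel_coords_vanish (c : 'cV[C]_n) : (forall i, i \notin zero_indices d a -> c i 0 = 0) ->
  derivatives_vanish (fun z => Q z *m (eval_mx T z *m c)) a 1.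
Proof.
move=> c0 [|//] j _; split => //=.
have : (eval_mx (invmx S) z *m (D z *m c)) j 0 @[z --> a^'] -->
    (eval_mx (invmx S) a *m (0 : 'cV[C]_n)) j 0.
  apply: mulmx_cvg => [|i k]; first exact: eval_mx_cvg.
  under eq_fun do rewrite mul_diag_mx !mxE; rewrite mxE ord1.
  have [iz|/c0->] := boolP (i \in zero_indices d a).
    have dc : d i z * c i 0 @[z --> a^'] --> 0 * c i 0.
      by apply: cvgM; [exact: zero_indices_cvg|exact: cvg_cst].
    by rewrite mul0r in dc.
  by under eq_fun do rewrite mulr0; exact: cvg_cst.
rewrite mulmx0 mxE; apply: dnbhs_eq_cvg; apply: filterS SQT => z SQTz.
by rewrite -SQTz !mulmxA eval_mulVmx// mul1mx.
Qed.

Lemma holomorphic_eval_mulmx (c : 'cV[C]_n) : mx_holomorphic_at (fun z => eval_mx T z *m c) a.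
Proof.
move=> i j.
have -> : (fun z => (eval_mx T z *m c) i j) = horner (\sum_k T i k * (c k j)%:P).
  apply/funext => z; rewrite mxE horner_sum; apply: eq_bigr => k _.
  by rewrite mxE !hornerE.
exact: holomorphic_horner.
Qed.

(** A vector v of the span is extended to the root function T (T(a)^-1 v), with
    constant coordinates in the basis of columns of T. *)
Lemma generalized_kernelE :
  generalized_kernel Q a = [set v | v \in <<[seq Tcol T i a | i in zero_indices d a]>>%VS].
Proof.
apply/seteqP; split => v /=.
  move=> [->|[phi [_ hphi _ dv] <-]]; first exact: mem0v.
  apply/memv_span_cols; first exact: eval_unitmx.
  by move=> i iz; rewrite invmx_eval//; exact: root_function_coord0.
move/memv_span_cols => /(_ (eval_unitmx _ uT)) vz.
have [->|v0] := eqVneq v 0; [by left|right].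
exists (fun z => eval_mx T z *m (invmx (eval_mx T a) *m v)); last first.
  by rewrite mulKVmx// eval_unitmx.
split=> //; first exact: holomorphic_eval_mulmx.
  by rewrite mulKVmx// eval_unitmx.
exact: kernel_coords_vanish.
Qed.

Lemma free_Tcol : free [seq Tcol T i a | i in zero_indices d a].
Proof. by apply: free_cols; exact: eval_unitmx. Qed.

Lemma dim_span_Tcol : \dim <<[seq Tcol T i a | i in zero_indices d a]>>%VS = #|zero_indices d a|.
Proof. by have := free_Tcol; rewrite /free => /eqP->; rewrite size_image. Qed.

End Diagonalized.

(** * Orders of the canonical root and pole cancellation functions *)

Section Orders.
Variables (R : realType) (n : nat).
Local Notation C := (Cplx R).
Variables (Q : C -> 'M[C]_n) (S T : 'M[{poly C}]_n) (d : 'I_n -> C -> C) (a : C).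
Hypothesis uS : unimodular S.
Hypothesis uT : unimodular T.
Hypothesis rd : forall i, rational_function (d i).
Hypothesis dn0 : forall i, exists z, d i z != 0.
Hypothesis SQT : \forall z \near a^',
  eval_mx S z *m Q z *m eval_mx T z = diag_mx (\row_i d i z).

Local Notation D z := (diag_mx (\row_i d i z)).
Local Notation Dinv z := (diag_mx (\row_i (d i z)^-1)).

Lemma near_diag_neq0 : \forall z \near a^', forall i, d i z != 0.
Proof.
apply: filter_forall => i; have [p [q [q0 pq dE]]] := rd i.
have p0 := numerator_neq0 dE (dn0 i).
apply: filterS2 (near_dnbhs_horner_neq0 a p0) (near_dnbhs_horner_neq0 a q0) => z pz qz.
by rewrite dE mulf_neq0// invr_eq0.
Qed.

Lemma diag_mulmxV z : (forall i, d i z != 0) -> D z *m Dinv z = 1%:M.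
Proof.
move=> dz; apply/matrixP => i j; rewrite mul_diag_mx !mxE mulrnAr.
by have [->|] := eqVneq i j; rewrite ?divff.
Qed.

Lemma near_unitmx : \forall z \near a^', Q z \in unitmx.
Proof.
apply: filterS2 SQT near_diag_neq0 => z SQTz /diag_mulmxV/mulmx1_unit[+ _].
by rewrite -SQTz !unitmx_mul => /andP[/andP[]].
Qed.

Lemma near_inv_diag : \forall z \near a^',
  eval_mx (invmx T) z *m mxfun_inv Q z *m eval_mx (invmx S) z = Dinv z.
Proof.
near=> z.
have Qz : Q z \in unitmx by near: z; exact: near_unitmx.
have DD : D z *m Dinv z = 1%:M by apply: diag_mulmxV; near: z; exact: near_diag_neq0.
have SQTz : eval_mx S z *m Q z *m eval_mx T z = D z by near: z.
rewrite -[LHS]mulmx1 -DD mulmxA -[RHS]mul1mx; congr (_ *m _).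
rewrite -SQTz -!mulmxA (mulmxA (eval_mx (invmx S) z)) eval_mulVmx// mul1mx.
by rewrite (mulmxA (mxfun_inv Q z)) mulVmx// mul1mx eval_mulVmx.
Unshelve. all: by end_near. Qed.

Lemma rational_near_inv i j : rational_near a (fun z => mxfun_inv Q z i j).
Proof.
have [p [q [q0 pq]]] : rational_near a (fun z => (eval_mx T z *m Dinv z *m eval_mx S z) i j).
  apply: rational_near_mulmx => [k l|k l]; last first.
    by under eq_fun do rewrite mxE; exact: rational_near_poly.
  apply: rational_near_mulmx => {k l} [k l|k l].
    by under eq_fun do rewrite mxE; exact: rational_near_poly.
  under eq_fun do rewrite !mxE.
  have [->|_] := eqVneq k l; last first.
    rewrite (_ : (fun z => _) = horner (0 : {poly C})); first exact: rational_near_poly.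
    by apply/funext => z; rewrite mulr0n horner0.
  have [p [q [q0 pq dE]]] := rd l.
  have p0 := numerator_neq0 dE (dn0 l).
  exists q, p; split => //; apply: filterS filterT => z _.
  by rewrite dE invf_div mulr1n.
exists p, q; split => //; apply: filterS2 pq near_inv_diag => z <- <-.
by rewrite !mulmxA eval_mulmxV// mul1mx -mulmxA eval_mulVmx// mulmx1.
Qed.

(** The columns of T and of S^-1 correspond to each other under Q, up to the
    scalar d_i; this identity produces both the root functions of Q and the
    pole cancellation functions of its inverse. *)
Lemma near_mulmx_Tcol : \forall z \near a^', forall i,
  Q z *m Tcol T i z = d i z *: Tcol (invmx S) i z.
Proof.
apply: filterS SQT => z SQTz i.
have -> : Q z *m Tcol T i z = col i (Q z *m eval_mx T z).
  by rewrite /Tcol !colE mulmxA.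
have -> : Q z *m eval_mx T z = eval_mx (invmx S) z *m D z.
  by rewrite -SQTz !mulmxA eval_mulVmx// mul1mx.
by apply/matrixP => k l; rewrite /Tcol mul_mx_diag !mxE mulrC.
Qed.

Lemma zero_order_rational i s : i \in zero_indices d a -> zero_of_order (d i) a s ->
  rational_zero_ge (d i) a s.
Proof.
move=> iz [s0 [g [hg ga dg]]]; have [p [q [q0 pq dE]]] := rd i.
have pa : root p a by rewrite -(zero_indicesP _ q0 pq dE).
have p0 := numerator_neq0 dE (dn0 i).
have pg : \forall z \near a^', p.[z] / q.[z] = (z - a) ^+ s * g z.
  by apply: filterS dg => z; rewrite dE.
have [p1 pE] := ratio_factor q0 pa pq p0 (holomorphic_continuous hg) ga pg.
exists p1, q; split; first exact: coprimep_root pq pa.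
apply: filterS filterT => z _.
by rewrite dE pE hornerM horner_exp hornerXsubC mulrA [_ * p1.[z]]mulrC.
Qed.

(** The entries of the root functions T_i after applying Q, and those of the
    pole cancellation functions, all have this shape d_i times a polynomial. *)
Lemma zero_orderM_vanish i s p l (f : C -> C) :
  i \in zero_indices d a -> zero_of_order (d i) a s ->
  (\forall z \near a^', f z = d i z * p.[z]) -> (l < s)%N ->
  (forall k, (k < l)%N -> \forall z \near a^', derivable (derive1n k f) z 1) /\
  derive1n l f z @[z --> a^'] --> (0 : C).
Proof.
move=> iz ds fE ls; apply: (rational_zero_ge_derivatives_vanish ls).
have [p1 [q [qa dE]]] := zero_order_rational iz ds.
exists (p1 * p), q; split=> //.
by apply: filterS2 fE dE => z -> ->; rewrite hornerM -!mulrA [_^-1 * _]mulrC.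
Qed.

Lemma Tcol_neq0 A i z : unimodular A -> Tcol A i z != 0 :> 'cV[C]_n.
Proof.
move=> uA; apply/eqP => A0.
have := invmx_mul_col (eval_unitmx z uA) i i.
by rewrite -/(Tcol A i z) A0 mulmx0 mxE eqxx => /eqP; rewrite eq_sym oner_eq0.
Qed.

Lemma root_function_ge_Tcol i s : i \in zero_indices d a -> zero_of_order (d i) a s ->
  root_function_ge Q a (Tcol T i) s.
Proof.
move=> iz ds; split.
- by case: ds.
- by move=> k j; under eq_fun do rewrite !mxE; exact: holomorphic_horner.
- exact: Tcol_neq0.
move=> l j ls; apply: (zero_orderM_vanish (p := invmx S j i) iz ds _ ls).
by apply: filterS near_mulmx_Tcol => z ->; rewrite !mxE.
Qed.

(** The i-th coordinate of phi in the basis of columns of T tends to 1, because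
    phi and T_i agree at a. *)
Lemma root_function_le i s phi m : zero_of_order (d i) a s ->
  root_function_ge Q a phi m -> phi a = Tcol T i a -> (m <= s)%N.
Proof.
move=> [s0 [g [hg ga dg]]] [m0 hphi _ dv] phia.
case: m m0 dv => // m _ dv.
have small : d i z * (eval_mx (invmx T) z *m phi z) i 0 / (z - a) ^+ m @[z --> a^'] --> (0 : C).
  by apply: (root_coord_small uT SQT); exact: dv.
have uc : (eval_mx (invmx T) z *m phi z) i 0 @[z --> a^'] -->
    (eval_mx (invmx T) a *m phi a) i (0 : 'I_1) by exact: holomorphic_coord_cvg.
apply: (zero_order_gt (holomorphic_continuous hg) ga dg uc _ small).
by rewrite phia -invmx_eval// invmx_mul_col ?eval_unitmx// eqxx oner_neq0.
Qed.

(** Were there no pole, all entries of the inverse would have limits, and so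
    would 1 / d_i, an entry of T^-1 Q^-1 S^-1; but d_i tends to 0. *)
Lemma pole_at_inv i : i \in zero_indices d a -> pole_at (mxfun_inv Q) a.
Proof.
move=> iz; apply: contrapT => np.
have cv k l : exists x : C, mxfun_inv Q z k l @[z --> a^'] --> x.
  have [[t pt]|//] := rational_near_pole_or_cvg (rational_near_inv k l).
  by exfalso; apply: np; exists k, l, t.
pose L := \matrix_(k, l) projT1 (cid (cv k l)).
have QL k l : mxfun_inv Q z k l @[z --> a^'] --> L k l.
  by rewrite mxE; case: cid.
have h : (eval_mx (invmx T) z *m mxfun_inv Q z *m eval_mx (invmx S) z) i i @[z --> a^'] -->
    (eval_mx (invmx T) a *m L *m eval_mx (invmx S) a) i i.
  by apply: mulmx_cvg; [apply: mulmx_cvg; [exact: eval_mx_cvg|exact: QL]|exact: eval_mx_cvg].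
have [x dinv] : exists x : C, (d i z)^-1 @[z --> a^'] --> x.
  eexists; apply: dnbhs_eq_cvg h; apply: filterS near_inv_diag => z ->.
  by rewrite !mxE eqxx mulr1n.
have d1 : d i z * (d i z)^-1 @[z --> a^'] --> (1 : C).
  apply: (@dnbhs_eq_cvg _ _ (fun=> 1)); last exact: cvg_cst.
  by apply: filterS near_diag_neq0 => z dz; rewrite divff.
have d0 : d i z * (d i z)^-1 @[z --> a^'] --> 0 * x.
  exact: (cvgM (zero_indices_cvg iz) dinv).
have := cvg_dnbhs_unique d0 d1.
by rewrite mul0r => /eqP; rewrite eq_sym oner_eq0.
Qed.

Lemma pole_cancellation_ge_Shat i s : i \in zero_indices d a -> zero_of_order (d i) a s ->
  pole_cancellation_ge (mxfun_inv Q) a (fun z => d i z *: Shat S i z) s.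
Proof.
move=> iz ds; split.
- by case: ds.
- exact: pole_at_inv iz.
- move=> j k; have [p [q [q0 pq dE]]] := rd i.
  have -> : (fun z => (d i z *: Shat S i z) j k) = (fun z => (p * invmx S j i).[z] / q.[z]).
    by apply/funext => z; rewrite mxE ShatE// /Tcol !mxE dE hornerM mulrAC.
  apply: holomorphic_ratio; apply: (coprimep_root pq).
  by rewrite -(zero_indicesP _ q0 pq dE).
- exists (Tcol T i a); first exact: Tcol_neq0.
  move=> j; rewrite /Tcol mxE.
  apply: dnbhs_eq_cvg (@eval_mx_cvg R n T a j i).
  apply: filterS2 near_mulmx_Tcol near_unitmx => z /(_ i) QT Qz.
  by rewrite ShatE// -QT mulKmx// mxE.
move=> l j ls; apply: (zero_orderM_vanish (p := invmx S j i) iz ds _ ls).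
by apply: filterS filterT => z _; rewrite mxE ShatE// /Tcol !mxE.
Qed.

(** Some entry of the i-th column of S^-1 does not vanish at a; it carries the
    order of d_i. *)
Lemma pole_cancellation_le i s m : zero_of_order (d i) a s ->
  pole_cancellation_ge (mxfun_inv Q) a (fun z => d i z *: Shat S i z) m -> (m <= s)%N.
Proof.
move=> [s0 [g [hg ga dg]]] [m0 _ _ _ dv].
case: m m0 dv => // m _ dv.
have /cV0Pn[j Sj] := Tcol_neq0 i a (unimodular_invmx uS).
rewrite /Tcol mxE in Sj.
have small : d i z * eval_mx (invmx S) z j i / (z - a) ^+ m @[z --> a^'] --> (0 : C).
  rewrite (_ : (fun z => _) = (fun z => (d i z *: Shat S i z) j 0 / (z - a) ^+ m)).
    by apply: derivatives_vanish_small => l lm; exact: dv.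
  by apply/funext => z; rewrite [in RHS]mxE ShatE// /Tcol [in RHS]mxE.
exact: zero_order_gt (holomorphic_continuous hg) ga dg (@eval_mx_cvg R n (invmx S) a j i) Sj small.
Qed.

End Orders.

(** * Passage to the inverse and conclusion *)

Section Main.
Variables (R : realType) (n : nat).
Local Notation C := (Cplx R).
Implicit Types (Q : C -> 'M[C]_n) (S T : 'M[{poly C}]_n) (d : 'I_n -> C -> C) (a : C).

(** The part of meromorphy that Q and its inverse share without regard to the
    values at singular points, so that it passes to the inverse. *)
Definition holomorphic_off_isolated Q :=
  forall a, \forall z \near a^', mx_holomorphic_at Q z.

Lemma meromorphic_off_isolated Q : mx_meromorphic_on_sphere Q -> holomorphic_off_isolated Q.
Proof.
move=> Qm a; apply: near_mx_holomorphic => i j; apply: meromorphic_derivable.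
by have [] := Qm i j.
Qed.

Lemma diagonalizes_near Q S T d a : diagonalizes Q S T d -> holomorphic_off_isolated Q ->
  \forall z \near a^', eval_mx S z *m Q z *m eval_mx T z = diag_mx (\row_i d i z).
Proof. by move=> [_ _ _ SQT] /(_ a); apply: filterS => z; exact: SQT. Qed.

Lemma diagonalizes_neq0 Q S T d : diagonalizes Q S T d -> det_not_identically_zero Q ->
  forall i, exists z, d i z != 0.
Proof.
move=> [uS uT _ SQT] [z [hz Qz]] i; exists z; apply/eqP => dz.
have : eval_mx S z *m Q z *m eval_mx T z \in unitmx.
  by rewrite !unitmx_mul !eval_unitmx// unitmxE unitfE Qz.
by rewrite SQT// unitmxE det_diag unitfE (bigD1 i)//= mxE dz mul0r eqxx.
Qed.

(** At a point a where Q^-1 is holomorphic, Q may be singular, with a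
    meaningless value.  There the identity T^-1 Q^-1 S^-1 = D^-1 is obtained by
    continuity from the nearby points; the limit of q / p is finite only if
    p(a) is nonzero, so that 1 / d_i has its correct value at a. *)
Lemma diagonalizes_inv Q S T d : diagonalizes Q S T d -> holomorphic_off_isolated Q ->
  (forall i, exists z, d i z != 0) ->
  diagonalizes (mxfun_inv Q) (invmx T) (invmx S) (fun i z => (d i z)^-1).
Proof.
move=> SQT hQ dn0; have [uS uT rd _] := SQT.
have near_diag a := near_inv_diag uS uT rd dn0 (diagonalizes_near a SQT hQ).
split; [exact: unimodular_invmx|exact: unimodular_invmx| |].
  move=> i; have [p [q [q0 pq dE]]] := rd i.
  exists q, p; split; last by move=> z; rewrite dE invf_div.
    exact: numerator_neq0 dE (dn0 i).
  by rewrite coprimep_sym.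
move=> a hinv.
set B := fun z => eval_mx (invmx T) z *m mxfun_inv Q z *m eval_mx (invmx S) z.
have Bc i j : B z i j @[z --> a^'] --> B a i j.
  apply: mulmx_cvg; last exact: eval_mx_cvg.
  apply: mulmx_cvg; first exact: eval_mx_cvg.
  by move=> k l; exact: (holomorphic_cvg (hinv k l)).
apply/matrixP => i j; rewrite -[LHS]/(B a i j) [RHS]mxE [X in X *+ _]mxE.
have [<-|ij] := eqVneq i j; last first.
  have B0 : B z i j @[z --> a^'] --> (0 : C).
    apply: (@dnbhs_eq_cvg _ _ (fun=> 0)); last exact: cvg_cst.
    by apply: filterS (near_diag a) => z Bz; rewrite /B Bz !mxE (negPf ij).
  by rewrite mulr0n; exact: (cvg_dnbhs_unique (Bc i j) B0).
rewrite mulr1n.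
have [p [q [q0 pq dE]]] := rd i.
have p0 := numerator_neq0 dE (dn0 i).
have pB : p.[z] * B z i i @[z --> a^'] --> p.[a] * B a i i.
  exact: (cvgM (@horner_cvg_dnbhs _ p a) (Bc i i)).
have pBq : p.[z] * B z i i @[z --> a^'] --> q.[a].
  apply: dnbhs_eq_cvg (@horner_cvg_dnbhs _ q a).
  apply: filterS2 (near_diag a) (near_dnbhs_horner_neq0 a p0) => z Bz pz.
  by rewrite /B Bz !mxE eqxx mulr1n dE invf_div mulrCA divff ?mulr1.
have pBa := cvg_dnbhs_unique pB pBq.
have pa : p.[a] != 0.
  apply/negP => pa; have := coprimep_root pq pa.
  by rewrite -pBa (eqP pa) mul0r eqxx.
by rewrite dE invf_div -pBa mulrAC divff// mul1r.
Qed.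

Lemma mxfun_inv_off_isolated Q S T d : diagonalizes Q S T d -> holomorphic_off_isolated Q ->
  (forall i, exists z, d i z != 0) -> holomorphic_off_isolated (mxfun_inv Q).
Proof.
move=> SQT hQ dn0 a; have [uS uT rd _] := SQT.
apply: near_mx_holomorphic => i j; apply: rational_near_derivable.
exact: (rational_near_inv uS uT rd dn0 (diagonalizes_near a SQT hQ)).
Qed.

Lemma mxfun_invK Q : mxfun_inv (mxfun_inv Q) = Q.
Proof. by apply/funext => z; exact: invmxK. Qed.

(** Both numbers of vanishing entries are the dimension of the generalized
    kernel, which is the same for the two diagonalizations. *)
Lemma geometric_multiplicity_span Q S T d a : diagonalizes Q S T d -> holomorphic_off_isolated Q ->
  geometric_multiplicity Q a (\dim <<[seq Tcol T i a | i in zero_indices d a]>>%VS).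
Proof.
move=> SQT hQ; split; first by exists S, T, d.
move=> S' T' d' SQT'.
have [uS uT rd _] := SQT; have [uS' uT' rd' _] := SQT'.
have /= kE := generalized_kernelE uS uT rd (diagonalizes_near a SQT hQ).
have := generalized_kernelE uS' uT' rd' (diagonalizes_near a SQT' hQ).
rewrite kE => /seteqP[sub sub'].
rewrite -(dim_span_Tcol d' a uT'); congr (\dim _).
by apply/vspaceP => v; apply/idP/idP => [/sub'|/sub].
Qed.

Lemma canonical_root_functions Q S T d a (s : 'I_n -> nat) :
  diagonalizes Q S T d -> holomorphic_off_isolated Q ->
  (forall i, exists z, d i z != 0) ->
  (forall i, i \in zero_indices d a -> zero_of_order (d i) a (s i)) ->
  let Ta := [seq Tcol T i a | i in zero_indices d a] in
  [/\ forall i, i \in zero_indices d a ->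
        [/\ root_function Q a (Tcol T i) (s i),
            eigenvector Q a (Tcol T i a) &
            canonical_root_function Q a (Tcol T i)],
      [/\ free Ta, geometric_multiplicity Q a (\dim <<Ta>>%VS) &
          generalized_kernel Q a = [set v | v \in <<Ta>>%VS]] &
      forall i, i \in zero_indices d a ->
        pole_cancellation_function (mxfun_inv Q) a (fun z => d i z *: Shat S i z) (s i)].
Proof.
move=> SQT hQ dn0 ds Ta; have [uS uT rd _] := SQT.
have SQTa := diagonalizes_near a SQT hQ.
split=> [i iz||i iz].
- have rT := root_function_ge_Tcol uS uT rd dn0 SQTa iz (ds i iz).
  have max phi m := root_function_le uT SQTa (ds i iz) (phi := phi) (m := m).
  have rfT : root_function Q a (Tcol T i) (s i).
    by split=> // m /max; exact.
  split=> //; last by exists (s i).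
  exists (Tcol T i) => //; case: rT => s0 hT T0 dv; split=> //.
  by move=> l j l1; apply: dv; exact: leq_trans l1 s0.
- split; first exact: free_Tcol.
    exact: geometric_multiplicity_span SQT hQ.
  exact: generalized_kernelE SQTa.
split; first exact: (pole_cancellation_ge_Shat uS uT rd dn0 SQTa iz (ds i iz)).
by move=> m; exact: (pole_cancellation_le uS (ds i iz)).
Qed.

Lemma pole_of_order_inv (f : C -> C) a t : pole_of_order f a t ->
  zero_of_order (fun z => (f z)^-1) a t.
Proof.
move=> [t0 [g [hg ga fE]]]; split=> //; exists (fun z => (g z)^-1); split.
- have gn : \forall z \near a, g z != 0.
    by apply: (cvgr_neq0 (FF := nbhs_filter a)) ga; exact: holomorphic_continuous.
  by apply: filterS2 hg gn => z dg gz; exact: derivableV.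
- by rewrite invr_eq0.
by apply: filterS fE => z ->; rewrite invf_div.
Qed.

End Main.

Theorem theorem2p5 (R : realType) (n : nat) (Q : Cplx R -> 'M[Cplx R]_n)
    (S T : 'M[{poly Cplx R}]_n) (d : 'I_n -> Cplx R -> Cplx R)
    (Qmero : mx_meromorphic_on_sphere Q)
    (detQ : det_not_identically_zero Q)
    (SQT : diagonalizes Q S T d) :
  (forall (alpha : Cplx R) (s : 'I_n -> nat),
     zero_at Q alpha ->
     (forall i, i \in zero_indices d alpha -> zero_of_order (d i) alpha (s i)) ->
     let Talpha := [seq Tcol T i alpha | i in zero_indices d alpha] in
     [/\ (* (i) *)
         forall i, i \in zero_indices d alpha ->
           [/\ root_function Q alpha (Tcol T i) (s i),
               eigenvector Q alpha (Tcol T i alpha) &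
               canonical_root_function Q alpha (Tcol T i)],
         (* (ii) *)
         [/\ free Talpha,
             geometric_multiplicity Q alpha (\dim <<Talpha>>%VS) &
             generalized_kernel Q alpha = [set v | v \in <<Talpha>>%VS]] &
         (* (vi) *)
         forall i, i \in zero_indices d alpha ->
           pole_cancellation_function (mxfun_inv Q) alpha
             (fun z => d i z *: Shat S i z) (s i)]) /\
  (forall (beta : Cplx R) (t : 'I_n -> nat),
     pole_at Q beta ->
     (forall j, j \in pole_indices d beta -> pole_of_order (d j) beta (t j)) ->
     let Sbeta := [seq Shat S j beta | j in pole_indices d beta] in
     [/\ (* (iii) *)
         forall j, j \in pole_indices d beta ->
           pole_cancellation_function Q beta
             (fun z => (d j z)^-1 *: Tcol T j z) (t j),
         (* (iv) *)
         forall j, j \in pole_indices d beta ->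
           [/\ root_function (mxfun_inv Q) beta (Shat S j) (t j),
               eigenvector (mxfun_inv Q) beta (Shat S j beta) &
               canonical_pole_function Q beta (Shat S j)] &
         (* (v) *)
         [/\ free Sbeta,
             pole_geometric_multiplicity Q beta (\dim <<Sbeta>>%VS) &
             generalized_kernel (mxfun_inv Q) beta =
               [set v | v \in <<Sbeta>>%VS]]]).
Proof.
have hQ := meromorphic_off_isolated Qmero.
have dn0 := diagonalizes_neq0 SQT detQ.
have [uS uT _ _] := SQT.
split=> [alpha s _ ds|beta t _ dt]; first exact: canonical_root_functions SQT hQ dn0 ds.
have invSQT := diagonalizes_inv SQT hQ dn0.
have dn0' i : exists z, (d i z)^-1 != 0.
  by have [z dz] := dn0 i; exists z; rewrite invr_eq0.
have ds j : j \in zero_indices (fun i z => (d i z)^-1) beta ->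
    zero_of_order (fun z => (d j z)^-1) beta (t j).
  by move=> jp; apply: pole_of_order_inv; exact: dt.
have := canonical_root_functions invSQT (mxfun_inv_off_isolated SQT hQ dn0) dn0' ds.
have TE j : Tcol (invmx S) j = Shat S j by apply/funext => z; rewrite ShatE.
have SE j : Shat (invmx T) j = Tcol T j.
  by apply/funext => z; rewrite ShatE ?invmxK//; exact: unimodular_invmx.
rewrite mxfun_invK.
have -> : [seq Tcol (invmx S) i beta | i in zero_indices (fun i z => (d i z)^-1) beta] =
    [seq Shat S j beta | j in pole_indices d beta] by apply: eq_map => j; rewrite TE.
move=> [rootS kerS poleT]; split=> [j jp|j jp|//].
  by have := poleT j jp; rewrite SE.
by have := rootS j jp; rewrite TE.
Qed.
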